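(* Let $k$ be a positive integer and let $G$ be a finite group. Then $s_k(G)=|G|-1$ if and only if the exponent $\exp(G)$ of $G$ divides $k$.
   Context: Let $G$ be a finite group and $k$ a positive integer. A subset $X\subseteq G$ is called $k$-power-avoiding if $\{g,g^k\}\not\subseteq X$ for every $g\in G$ (in particular, $X$ contains no element $g$ with $g^k=g$). Define $s_k(G)=\max\{|X| : X\subseteq G \text{ is } k\text{-power-avoiding}\}$. *)

(* Defs.v *)
From HB Require Import structures.
From mathcomp Require Import all_boot all_fingroup all_solvable.
Set Implicit Arguments.
Unset Strict Implicit.
Unset Printing Implicit Defensive.

Local Open Scope group_scope.

Definition power_avoiding (gT : finGroupType) (k : nat) (G : {group gT})
    (X : {set gT}) : bool :=
  (X \subset G) && [forall g in G, ~~ ([set g; g ^+ k] \subset X)].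

(* set0 is always power-avoiding, so this is a maximum over a nonempty family. *)
Definition max_power_avoiding (gT : finGroupType) (k : nat) (G : {group gT})
    : nat :=
  \max_(X : {set gT} | power_avoiding k G X) #|X|.

(* Main.v *)
(** A power-avoiding set misses 1, since 1 ^+ k = 1. So the maximum is #|G| - 1
    exactly when G^# itself is power-avoiding, i.e. when g ^+ k leaves G^# for
    every g in G^#, which says that x ^+ k = 1 throughout G. *)
Require Import Defs.
From HB Require Import structures.
From mathcomp Require Import all_boot all_fingroup all_solvable.
Set Implicit Arguments.
Unset Strict Implicit.
Unset Printing Implicit Defensive.

Lemma power_avoiding_sub_setD1 (gT : finGroupType) (G : {group gT}) (k : nat)
    (X : {set gT}) :
  power_avoiding k G X -> X \subset G^#%g.
Proof.
case/andP=> sXG /forall_inP avX; rewrite subsetD1 sXG.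
by have := avX 1%g (group1 G); rewrite expg1n setUid sub1set.
Qed.

Lemma power_avoiding_setD1 (gT : finGroupType) (G : {group gT}) (k : nat) :
  power_avoiding k G G^#%g = (exponent G %| k).
Proof.
rewrite /power_avoiding subsetDl; apply/forall_inP/exponentP=> [avG g Gg | expG g Gg].
  have := avG g Gg; rewrite subUset !sub1set !inE Gg groupX // !andbT.
  (* For [g != 1] avoidance reduces to [g ^+ k = 1]; at [g = 1] it gives no information, but the
     equation is trivial. *)
  by have [->|_ /negPn/eqP] := eqVneq g 1%g; first rewrite expg1n.
by rewrite subUset !sub1set expG // !inE eqxx andbF.
Qed.

Theorem theorem6 (gT : finGroupType) (G : {group gT}) (k : nat) (hk : 0 < k) :
  max_power_avoiding k G = #|G| - 1 <-> exponent G %| k.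
Proof.
have cardD1 : #|G^#%g| = #|G| - 1 by rewrite (cardsD1 1%g G) group1 addKn.
rewrite -cardD1 -power_avoiding_setD1 /max_power_avoiding; split=> [maxE | avG].
  (* The empty set makes the family nonempty, so that some [X] attains the maximum. *)
  have av0 : power_avoiding k G set0.
    rewrite /power_avoiding sub0set; apply/forall_inP=> g _.
    by rewrite subUset sub1set inE.
  have [|X avX] := @eq_bigmax_cond _ (power_avoiding k G) (fun X => #|X|).
    by apply/card_gt0P; exists set0.
  (* An extremal [X] lies inside [G^#] and has its cardinality, so [G^#] is itself the avoiding set
     [X]. *)
  rewrite maxE => cardX; suff <- : X = G^#%g by [].
  by apply/eqP; rewrite eqEcard (power_avoiding_sub_setD1 avX) cardX leqnn.
apply/eqP; rewrite eqn_leq (bigmax_sup G^#%g) // andbT.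
by apply/bigmax_leqP=> X /power_avoiding_sub_setD1/subset_leq_card.
Qed.
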